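(* There exist universal positive constants $C_1, C_2, C_3, c$ such that the following holds for all positive integers $m,n$, every fixed vector $\boldsymbol{x}\in\mathbb{R}^n$ and every $u>0$. Let $\boldsymbol{a}_1,\dots,\boldsymbol{a}_m$ be independent $\mathcal{N}(\boldsymbol{0},\boldsymbol{I})$ random vectors in $\mathbb{R}^n$. Then with probability at least $1-\exp[-cm\min(u,u^2)]$, the inequality $$-\Big\langle \boldsymbol{h},\tfrac{1}{2m}\nabla l(\boldsymbol{z})\Big\rangle\ \ge\ \Big(1-C_3-\Big(C_1\frac{n}{m}+C_2\sqrt{\frac{n}{m}}\Big)-u\Big)\|\boldsymbol{h}\|^2$$ holds simultaneously for all $\boldsymbol{h}\in\mathbb{R}^n$, where $\boldsymbol{z}=\boldsymbol{x}-\boldsymbol{h}$ and $\nabla l$ is the TanhWFQ gradient in the noiseless setting.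
   Context: All vectors are real and $\|\cdot\|$ is the Euclidean norm. In the noiseless setting the measurements of the true signal $\boldsymbol{x}$ are $y_i=|\boldsymbol{a}_i^T\boldsymbol{x}|^2$, $i=1,\dots,m$. For an estimate $\boldsymbol{z}\in\mathbb{R}^n$, the error is $\boldsymbol{h}=\boldsymbol{x}-\boldsymbol{z}$, and the TanhWFQ gradient is $$\frac{1}{2m}\nabla l(\boldsymbol{z})=\frac1m\sum_{i=1}^m \boldsymbol{a}_i\left(\boldsymbol{a}_i^T\boldsymbol{z}-\boldsymbol{a}_i^T\boldsymbol{x}\,\tanh\frac{(\boldsymbol{a}_i^T\boldsymbol{x})(\boldsymbol{a}_i^T\boldsymbol{z})}{\sigma_i^2}\right),\qquad \sigma_i^2=\big(|\boldsymbol{a}_i^T\boldsymbol{x}|-|\boldsymbol{a}_i^T\boldsymbol{z}|\big)^2.$$ Convention: if $\sigma_i^2=0$, the factor $\tanh(\cdot)$ is understood as its limiting value $\mathrm{sgn}\big((\boldsymbol{a}_i^T\boldsymbol{x})(\boldsymbol{a}_i^T\boldsymbol{z})\big)$, with $\mathrm{sgn}(0)=0$. *)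

(* Defs.v *)
From HB Require Import structures.
From mathcomp Require Import all_boot all_order all_algebra.
From mathcomp Require Import all_classical all_reals all_analysis.

Set Implicit Arguments.
Unset Strict Implicit.
Unset Printing Implicit Defensive.

Import Order.TTheory GRing.Theory Num.Theory.

Local Open Scope classical_set_scope.
Local Open Scope ring_scope.

Section Euclidean.
Context {R : realType} {n : nat}.

Definition dot (u v : 'cV[R]_n) : R := (u^T *m v) 0 0.

(* The library norm on matrices is the sup norm, hence a separate definition. *)
Definition enorm (u : 'cV[R]_n) : R := Num.sqrt (dot u u).

Definition vec_of_tuple (t : n.-tuple R) : 'cV[R]_n := \col_j tnth t j.

End Euclidean.

Section TanhWFQ.
Context {R : realType}.

Definition tanh (t : R) : R :=
  (expR t - expR (- t)) / (expR t + expR (- t)).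

(* In the next two definitions, p stands for a_i^T x and q for a_i^T z. *)
Definition sigma2 (p q : R) : R := (`|p| - `|q|) ^+ 2.

(* When sigma2 p q = 0, tanh (p q / sigma2 p q) is read as its limit. *)
Definition tanh_factor (p q : R) : R :=
  if sigma2 p q == 0 then Num.sg (p * q) else tanh (p * q / sigma2 p q).

(* This is the normalized gradient (1 / 2m) \nabla l(z), for noiseless
   measurements |a_i^T x|^2. *)
Definition tanhwfq_grad {m n : nat} (a : 'I_m -> 'cV[R]_n) (x z : 'cV[R]_n) :
    'cV[R]_n :=
  m%:R^-1 *: \sum_(i < m)
    (dot (a i) z - dot (a i) x * tanh_factor (dot (a i) x) (dot (a i) z))
      *: a i.

End TanhWFQ.

Section Probability.
Context {d : measure_display} {T : measurableType d} {R : realType}.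
Variable P : probability T R.

Definition independent_RVs {I : finType} {d' : measure_display}
    {T' : measurableType d'} (X : I -> {RV P >-> T'}) : Prop :=
  forall (J : {set I}) (B : I -> set T'), (forall i, measurable (B i)) ->
    P (\bigcap_(i in [set` J]) (X i @^-1` B i)) =
    (\prod_(i in J) P (X i @^-1` B i))%E.

(* X ~ N(0, I_n): the law of X agrees with the n-fold product of N(0, 1) on
   measurable boxes.  These form a pi-system generating the sigma-algebra of
   n.-tuple R, so this determines the law.  The second parameter of
   normal_prob is the standard deviation. *)
Definition std_gaussian_vector {n : nat} (X : {RV P >-> n.-tuple R}) : Prop :=
  forall B : 'I_n -> set R, (forall j, measurable (B j)) ->
    distribution P X [set t : n.-tuple R | forall j, B j (tnth t j)] =
    (\prod_(j < n) normal_prob 0 1 (B j))%E.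

End Probability.

(* Main.v *)
Require Import Defs.
From HB Require Import structures.
From mathcomp Require Import all_boot all_order all_algebra.
From mathcomp Require Import all_classical all_reals all_analysis.
From mathcomp Require Import archimedean measurable_realfun ring lra.

Import Order.TTheory GRing.Theory Num.Theory.

Local Open Scope classical_set_scope.
Local Open Scope ring_scope.

(** Write p = a_i^T x, q = a_i^T z, s = p - q and tau for the tanh factor. The
    summand of - <h, grad> is s^2 - s p (1 - tau), and |p| (1 - tau) <= 4 |s|: either
    |p| <= 2 |s|, or p and q have the same sign with |q| >= |s|, where
    1 - tanh t <= 1/t applies to t = p q / s^2. So, deterministically,
    - <h, grad> >= - (3/m) sum_i (a_i^T h)^2, and as C_3 may be large only an
    upper tail for the operator norm of the Gaussian matrix A is needed.

    For that, rescale vectors of R^N to norm at most sqrt N and round them to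
    integer vectors of squared norm at most 4N; there are at most e^(6N) of
    these. The form k^T A l is linear in each argument, so rounding each
    coordinate in the favourable direction only increases it, and bounding
    k^T A l on the integer vectors bounds the operator norm. Markov's
    inequality is applied to the sum of exp (lambda k^T A l) over all pairs. *)

(** * Deterministic bounds on one summand *)

Section Pointwise.
Context {R : realType}.
Implicit Types p q t w c : R.

Lemma tanh_geN1 t : -1 <= Defs.tanh t.
Proof.
rewrite /Defs.tanh ler_pdivlMr ?addr_gt0 ?expR_gt0//.
by have := expR_gt0 t; have := expR_gt0 (- t); lra.
Qed.

Lemma tanh_le1 t : Defs.tanh t <= 1.
Proof.
rewrite /Defs.tanh ler_pdivrMr ?addr_gt0 ?expR_gt0//.
by have := expR_gt0 t; have := expR_gt0 (- t); lra.
Qed.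

(** Writing 1 - tanh t as 2 e^(-t) / (e^t + e^(-t)) and factoring out e^(-t), this reduces to 2t <=
    1 + e^(2t). *)
Lemma onem_tanh_le t : 0 < t -> 1 - Defs.tanh t <= t^-1.
Proof.
move=> t0; have e0 := expR_gt0 t; have en0 := expR_gt0 (- t).
have -> : 1 - Defs.tanh t = 2 * expR (- t) / (expR t + expR (- t)).
  by rewrite /Defs.tanh; field; rewrite gt_eqF ?addr_gt0.
rewrite ler_pdivrMr ?addr_gt0// [leRHS]mulrC ler_pdivlMr//.
have -> : expR t = expR (- t) * expR (2 * t).
  by rewrite -expRD; congr expR; ring.
have := expR_ge1Dx (2 * t); nra.
Qed.

Lemma tanh_factor_geN1 p q : -1 <= tanh_factor p q.
Proof.
rewrite /Defs.tanh_factor; case: ifP => _; last exact: tanh_geN1.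
by case: sgrP => _; lra.
Qed.

Lemma tanh_factor_le1 p q : tanh_factor p q <= 1.
Proof.
rewrite /tanh_factor; case: ifP => _; last exact: tanh_le1.
by case: sgrP => _; lra.
Qed.

Lemma norm_onem_tanh_factor_le p q :
  `|p| * (1 - tanh_factor p q) <= 4 * `|p - q|.
Proof.
have hT := tanh_factor_geN1 p q.
(* When |p| <= 2 |p - q|, the trivial bound 1 - tau <= 2 suffices. This also covers p = - q, where
   [sigma2] vanishes. *)
have [ps|ps] := leP `|p| (2 * `|p - q|).
  by have := normr_ge0 p; nra.
(* For p = q the limiting convention gives tau = sgn(q^2), which is 1 unless q = 0; the left side is
   0 in both cases. *)
have [->|pq] := eqVneq p q.
  rewrite subrr normr0 mulr0 /tanh_factor /sigma2 subrr expr0n /= eqxx.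
  have [->|q0] := eqVneq q 0; first by rewrite normr0 mul0r.
  by rewrite gtr0_sg ?subrr ?mulr0// -expr2 exprn_even_gt0.
have s0 : 0 < `|p - q| by rewrite normr_gt0 subr_eq0.
have [q0 pq0] : `|p - q| <= `|q| /\ 0 < p * q.
  have := ler_normD (p - q) q; rewrite subrK => h; split; first by lra.
  by move: ps; case: (ger0P p); case: (ger0P (p - q)); nra.
(* As p and q have the same sign, | |p| - |q| | = |p - q|, which is now nonzero, so the factor is a
   genuine tanh. *)
have E : sigma2 p q = (p - q) ^+ 2.
  rewrite /sigma2 -[RHS]real_normK ?num_real//.
  by case: (ger0P p); case: (ger0P q) => ? ?; rewrite ?real_normK ?num_real//; nra.
rewrite /Defs.tanh_factor E sqrf_eq0 subr_eq0 (negbTE pq).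
have s2 : 0 < (p - q) ^+ 2 by rewrite exprn_even_gt0//= subr_eq0.
have := @onem_tanh_le (p * q / (p - q) ^+ 2) (divr_gt0 pq0 s2).
rewrite invf_div => h.
apply: (le_trans (ler_wpM2l (normr_ge0 p) h)).
rewrite mulrCA -[X in X * _]real_normK ?num_real// expr2.
have -> : `|p| / (p * q) = `|q|^-1.
  rewrite -[p * q]gtr0_norm// normrM; field.
  by rewrite !gt_eqF//; nra.
rewrite ler_pdivrMr; nra.
Qed.

Lemma tanhwfq_term_ge p q :
  - 3 * (p - q) ^+ 2 <= - ((q - p * tanh_factor p q) * (p - q)).
Proof.
have h := norm_onem_tanh_factor_le p q.
set T := tanh_factor p q in h *; set s := p - q in h *.
have h1 : p * (1 - T) * s <= `|p| * (1 - T) * `|s|.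
  apply: (le_trans (ler_norm _)); rewrite !normrM.
  by rewrite (ger0_norm (x := 1 - T)) ?subr_ge0 ?tanh_factor_le1.
have h2 := ler_wpM2r (normr_ge0 s) h.
have h3 : `|s| * `|s| = s ^+ 2 by rewrite -expr2 real_normK ?num_real.
have -> : - ((q - p * T) * s) = s ^+ 2 - p * (1 - T) * s by rewrite /s; ring.
by nra.
Qed.

End Pointwise.

(** * Extending integral identities from indicators to nonnegative functions *)

Section IntegralFromIndicators.
Context {d d'} {T : measurableType d} {Y : measurableType d'} {R : realType}.
Variables (mu : {measure set T -> \bar R}) (nu : {measure set Y -> \bar R}).
Local Open Scope ereal_scope.
Import HBNNSimple.

(** Approximate f from below by simple functions, pass to the limit on both sides by monotone
    convergence, and expand each simple function over its values. The weight [Phi] serves two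
    purposes: as a density with [X] the identity, and as the product of the remaining factors in a
    product expectation. *)
Lemma integral_mul_comp_from_indic (Phi : T -> R) (X : T -> Y) (c : R)
    (f : Y -> R) :
  measurable_fun setT Phi -> (forall x, (0 <= Phi x)%R) ->
  measurable_fun setT X -> (0 <= c)%R ->
  measurable_fun setT f -> (forall y, (0 <= f y)%R) ->
  (forall B, measurable B ->
    \int[mu]_x (Phi x * \1_B (X x))%:E = c%:E * nu B) ->
  \int[mu]_x (Phi x * f (X x))%:E = c%:E * \int[nu]_y (f y)%:E.
Proof.
move=> mPhi Phi0 mX c0 mf f0 Hind.
have mEf : measurable_fun [set: Y] (EFin \o f) by exact/measurable_EFinP.
pose h := nnsfun_approx measurableT mEf.
have mhX n : measurable_fun setT (fun x => (Phi x * h n (X x))%R).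
  by apply: measurable_funM => //; exact: measurableT_comp.
have hcvg y : (h n y)%:E @[n --> \oo] --> (f y)%:E.
  by apply: (cvg_nnsfun_approx measurableT mEf) => // t _; rewrite lee_fin.
have hnd y : nondecreasing_seq (fun n => h n y).
  by move=> a b ab; exact/lefP/nd_nnsfun_approx.
have -> : \int[nu]_y (f y)%:E = limn (fun n => \int[nu]_y (h n y)%:E).
  rewrite -monotone_convergence//=.
  - by apply: eq_integral => y _; apply/esym/cvg_lim => //; exact: hcvg.
  - by move=> n; exact/measurable_EFinP.
  - by move=> n y _; rewrite lee_fin.
  - by move=> y _ a b ab; rewrite lee_fin; exact: hnd.
have -> : \int[mu]_x (Phi x * f (X x))%:E =
    limn (fun n => \int[mu]_x (Phi x * h n (X x))%:E).
  rewrite -monotone_convergence//=.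
  - apply: eq_integral => x _; apply/esym/cvg_lim => //.
    under eq_fun do rewrite EFinM.
    by rewrite EFinM; apply: cvgeZl => //; exact: hcvg.
  - by move=> n; exact/measurable_EFinP.
  - by move=> n x _; rewrite lee_fin mulr_ge0.
  - by move=> x _ a b ab; rewrite lee_fin ler_wpM2l//; exact: hnd.
rewrite -limeMl//; last first.
  apply: ereal_nondecreasing_is_cvgn => a b ab; apply: ge0_le_integral => //.
  - by move=> x _; rewrite lee_fin.
  - exact/measurable_EFinP.
  - exact/measurable_EFinP.
  - by move=> x _; rewrite lee_fin; exact: hnd.
congr (limn _); apply/funext => n.
have hE y : (h n y)%:E = \sum_(r \in range (h n)) (r * \1_(h n @^-1` [set r]) y)%:E.
  by rewrite fimfunE -fsumEFin.
under eq_integral do rewrite EFinM hE.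
under eq_integral.
  move=> x _; rewrite ge0_mule_fsumr; last first.
    by move=> r; rewrite EFinM nnfun_muleindic_ge0.
  over.
rewrite ge0_integral_fsum//=; last 2 first.
- move=> r; apply: emeasurable_funM; first exact/measurable_EFinP.
  apply/measurable_EFinP/measurable_funM => //.
  by apply: measurableT_comp => //; exact: measurable_indic.
- by move=> r x _; rewrite mule_ge0 ?lee_fin// -lee_fin EFinM nnfun_muleindic_ge0.
under [in RHS]eq_integral do rewrite hE.
rewrite ge0_integral_fsum//=; last 2 first.
- by move=> r; apply/measurable_EFinP/measurable_funM => //; exact: measurable_indic.
- by move=> r x _; rewrite EFinM nnfun_muleindic_ge0.
rewrite ge0_mule_fsumr; last first.
  by move=> r; apply: integral_ge0 => y _; rewrite EFinM nnfun_muleindic_ge0.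
apply: eq_fsbigr => r /[!inE] -[y _ hy].
have r0 : (0 <= r)%R by rewrite -hy.
rewrite integralZl_indic_nnsfun//= integral_indic// setIT muleCA -Hind//.
rewrite -ge0_integralZl//; last 2 first.
- apply/measurable_EFinP/measurable_funM => //.
  by apply: measurableT_comp => //; exact: measurable_indic.
- by move=> x _; rewrite lee_fin mulr_ge0.
by apply: eq_integral => x _; rewrite -!EFinM mulrCA.
Qed.

End IntegralFromIndicators.

(** * Exponential moments of a normal variable and expectations of products *)

Lemma normal_prob_mgf {R : realType} (s : R) :
  (\int[normal_prob 0 1]_x (expR (s * x))%:E = (expR (s ^+ 2 / 2))%:E)%E.
Proof.
have mexp : measurable_fun setT (fun x : R => expR (s * x)).
  by apply: measurableT_comp => //; exact: measurable_funM.
rewrite -[LHS]mul1e -(@integral_mul_comp_from_indic _ _ _ _ _ lebesgue_measure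
  (normal_prob 0 1) (normal_pdf 0 1) id)//; first last.
- move=> B mB; rewrite mul1e /normal_prob [RHS]integral_mkcond.
  by apply: eq_integral => x _; rewrite /= epatch_indic EFinM.
- by move=> y; exact: normal_pdf_ge0.
- exact: measurable_normal_pdf.
(* Completing the square: e^(sx) times the N(0, 1) density is e^(s^2/2) times the N(s, 1) density,
   whose integral is 1. *)
rewrite -[RHS]mule1 -(integral_normal_pdf s (1 : R)) -ge0_integralZl//=; last 2 first.
- by apply/measurable_EFinP; exact: measurable_normal_pdf.
- by move=> x _; rewrite lee_fin normal_pdf_ge0.
apply: eq_integral => x _; rewrite -EFinM !normal_pdfE ?oner_neq0//.
congr (_%:E); rewrite mulrCA -mulrA; congr (_ * _).
by rewrite /normal_fun -!expRD; congr expR; field.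
Qed.

Section ProductExpectation.
Context {d d'} {T : measurableType d} {Y : measurableType d'} {R : realType}.
Variables (P : probability T R) (nu : probability Y R).
Variables (I : finType) (X : I -> T -> Y).
Hypothesis mX : forall k, measurable_fun setT (X k).
Hypothesis iidX : forall B : I -> set Y, (forall k, measurable (B k)) ->
  P (\bigcap_k (X k @^-1` B k)) = (\prod_k nu (B k))%E.

Lemma expectation_prod_iid (g : I -> Y -> R) (M : I -> R) :
  (forall k, measurable_fun setT (g k)) -> (forall k y, 0 <= g k y) ->
  (forall k, \int[nu]_y (g k y)%:E = (M k)%:E)%E ->
  (\int[P]_x (\prod_k g k (X k x))%:E = (\prod_k M k)%:E)%E.
Proof.
suff gen (s : seq I) : forall (g : I -> Y -> R) (M : I -> R),
    (forall k, measurable_fun setT (g k)) -> (forall k y, 0 <= g k y) ->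
    (forall k, k \notin s -> exists2 B, measurable B & g k = \1_B) ->
    (forall k, \int[nu]_y (g k y)%:E = (M k)%:E)%E ->
    (\int[P]_x (\prod_k g k (X k x))%:E = (\prod_k M k)%:E)%E.
  by move=> mg g0; apply: (gen (enum I)) => // k; rewrite mem_enum.
elim: s => [|k0 s IH] {}g {}M mg g0 gind gM.
  have /choice[B HB] : forall k, exists B, measurable B /\ g k = \1_B.
    by move=> k; have [//|B mB gB] := gind k; exists B.
  have mB k := (HB k).1; have gB k := (HB k).2.
  have MB k : ((M k)%:E = nu (B k))%E.
    by rewrite -gM gB integral_indic// setIT.
  rewrite -(@prodEFin); under [RHS]eq_bigr do rewrite MB.
  rewrite -iidX//.
  have mI : measurable (\bigcap_k (X k @^-1` B k)).
    apply: fin_bigcap_measurable => // k _.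
    by rewrite -[X in measurable X]setTI; exact: mX.
  transitivity (\int[P]_x (\1_(\bigcap_k (X k @^-1` B k)) x)%:E)%E; last first.
    by rewrite integral_indic// setIT.
  apply: eq_integral => x _; congr (_%:E).
  under eq_bigr do rewrite gB.
  rewrite indicE; have [xB|xB] := boolP (x \in _); move: xB; rewrite ?inE ?notin_setE.
    by move=> xB; rewrite big1// => k _; rewrite indicE mem_set//; exact: xB.
  move/existsNP => [k /not_implyP[_ xB]].
  by rewrite (bigD1 k)//= indicE memNset ?mul0r.
have M0 k : 0 <= M k.
  by rewrite -lee_fin -gM integral_ge0// => y _; rewrite lee_fin.
under eq_integral do rewrite (bigD1 k0)//= mulrC.
rewrite (bigD1 k0)//= mulrC EFinM -gM.
apply: integral_mul_comp_from_indic => //.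
- under eq_fun do rewrite -big_filter.
  by apply: measurable_prod => k _; exact: measurableT_comp.
- by move=> x; apply: prodr_ge0.
- by apply: prodr_ge0.
move=> B mB.
(* With the factor at [k0] replaced by an indicator, only the indices in [s] remain unrestricted and
   the induction hypothesis applies. *)
pose g' k := if k == k0 then \1_B else g k.
pose M' k := if k == k0 then fine (nu B) else M k.
have nuB : nu B \is a fin_num by exact: fin_num_measure.
have E1 x : \prod_(k | k != k0) g k (X k x) * \1_B (X k0 x) =
    \prod_k g' k (X k x).
  rewrite [RHS](bigD1 k0)//= {1}/g' eqxx mulrC; congr (_ * _).
  by apply: eq_bigr => k /negbTE kk0; rewrite /g' kk0.
under eq_integral do rewrite E1.
have -> : ((\prod_(k | k != k0) M k)%:E * nu B = (\prod_k M' k)%:E)%E.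
  rewrite [in RHS](bigD1 k0)//= {1}/M' eqxx mulrC EFinM fineK//.
  by congr (_%:E * _)%E; apply: eq_bigr => k /negbTE kk0; rewrite /M' kk0.
apply: IH; rewrite /g' /M'.
- by move=> k; case: ifP.
- by move=> k y; case: ifP.
- move=> k ks; case: ifPn => [_|kk0]; first by exists B.
  by apply: gind; rewrite inE negb_or kk0.
- move=> k; case: ifP => // _.
  by rewrite integral_indic// setIT fineK.
Qed.

End ProductExpectation.

(** * The integer grid: counting, rounding and the operator norm *)

(* A pair (b, k) encodes the integer (-1)^b k; 0 is encoded twice. *)
Definition grid (N : nat) : {set {ffun 'I_N -> bool * 'I_N.+2}} :=
  [set k : {ffun 'I_N -> bool * 'I_N.+2} | (\sum_j (k j).2 ^ 2 <= 4 * N)%N].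

Section IntegerGrid.
Context {R : realType}.

Definition grid_coord {M : nat} (s : bool * 'I_M) : R := (-1) ^+ s.1 * s.2%:R.

Lemma sqr_grid_coord M (s : bool * 'I_M) : grid_coord s ^+ 2 = s.2%:R ^+ 2.
Proof. by rewrite /grid_coord exprMn sqrr_sign mul1r. Qed.

Lemma mem_grid N (k : {ffun 'I_N -> bool * 'I_N.+2}) :
  (k \in grid N) = (\sum_j grid_coord (k j) ^+ 2 <= 4 * N%:R).
Proof.
rewrite inE -(ler_nat R) natrM natr_sum; congr (_ <= _).
by apply: eq_bigr => j _; rewrite sqr_grid_coord natrX.
Qed.

Lemma sum_expRN_sqr_le M : \sum_(k < M) expR (- (k%:R ^+ 2)) <= 2 :> R.
Proof.
(* Comparison with a geometric series: e^(k^2) >= e^k >= 2^k. The exact partial sum makes the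
   induction go through. *)
suff : \sum_(k < M) expR (- (k%:R ^+ 2)) <= 2 - 2 * 2^-1 ^+ M :> R.
  by move/le_trans; apply; rewrite gerBl mulr_ge0// exprn_ge0.
elim: M => [|M IH]; first by rewrite big_ord0 expr0; lra.
rewrite big_ord_recr/= [in leRHS]exprS.
suff : expR (- (M%:R ^+ 2)) <= (2^-1 : R) ^+ M.
  by move: IH; set x := (2^-1 : R) ^+ M; lra.
rewrite exprVn expRN lef_pV2 ?posrE ?expR_gt0 ?exprn_gt0//.
apply: (@le_trans _ _ (expR M%:R)).
  rewrite -[in leRHS](mulr1 M%:R) expRM_natl.
  by apply: lerXn2r; rewrite ?nnegrE ?expR_ge0//; have := expR_ge1Dx (1 : R).
by rewrite ler_expR -natrX ler_nat; case: M {IH} => // M; rewrite leq_pmulr.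
Qed.

(** A grid point has weight prod_j exp (4 - k_j^2) >= 1, so the cardinality is at most the total
    weight of all integer vectors in the box. That total factors over coordinates into the N-th
    power of a sum which, with two signs, is at most e^4 * 2 * 2 <= e^6. *)
Lemma card_grid_le N : #|grid N|%:R <= expR (6 * N%:R) :> R.
Proof.
rewrite -sumr_const.
apply: (@le_trans _ _ (\sum_(k : {ffun 'I_N -> bool * 'I_N.+2})
    \prod_j expR (4 - grid_coord (k j) ^+ 2))).
  rewrite big_mkcond/=; apply: ler_sum => k _; case: ifPn => [|_].
    rewrite mem_grid => hk; rewrite -expR_sum -[leLHS]expR0 ler_expR.
    by rewrite big_split/= sumr_const card_ord sumrN -[4 *+ N]mulr_natr subr_ge0.
  by apply: prodr_ge0 => j _; exact: expR_ge0.
rewrite -(bigA_distr_bigA (fun (j : 'I_N) s => expR (4 - grid_coord s ^+ 2))).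
rewrite prodr_const card_ord mulrC expRM_natl.
apply: lerXn2r; rewrite ?nnegrE ?expR_ge0 ?sumr_ge0//.
rewrite -(pair_bigA _ (fun b k => expR (4 - grid_coord (b, k) ^+ 2)))/=.
under eq_bigr do (under eq_bigr do rewrite sqr_grid_coord expRD; rewrite -mulr_sumr).
rewrite /= sumr_const card_bool.
have h := sum_expRN_sqr_le N.+2; have e4 := expR_gt0 (4 : R).
have e1 : 2 <= expR 1 :> R by have := expR_ge1Dx (1 : R).
have -> : expR 6 = expR 4 * (expR 1 * expR 1) :> R.
  by rewrite -!expRD; congr expR; ring.
rewrite -mulrnAr ler_pM2l// mulr2n; nra.
Qed.

Lemma grid_round_coord M (w c : R) : `|w| + 1 < M%:R ->
  exists s : bool * 'I_M,
    grid_coord s ^+ 2 <= 2 * w ^+ 2 + 2 /\ w * c <= grid_coord s * c.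
Proof.
wlog w0 : w c / 0 <= w => [hw wM|].
  have [w0|/ltW w0] := leP 0 w; first exact: hw.
  have [||[b k] [h1 h2]] := hw (- w) (- c); rewrite ?oppr_ge0 ?normrN//.
  exists (~~ b, k); move: h1 h2; rewrite !sqr_grid_coord sqrrN mulrNN; split=> //.
  by apply: (le_trans h2); rewrite /grid_coord/= signrN mulrN !mulNr.
rewrite ger0_norm// => wM.
have /andP[t1 t2] := Num.Theory.truncn_itv w0.
move: t1 t2; set k := Num.truncn w => t1 t2.
have kM : (k.+1 < M)%N by rewrite -(ltr_nat R) -natr1; lra.
have k0 : 0 <= k%:R :> R by [].
(* Round w up if c >= 0 and down otherwise. Rounding up costs (w + 1)^2 <= 2 w^2 + 2. *)
have [c0|c0] := leP 0 c.
  exists (false, Ordinal kM); rewrite sqr_grid_coord /grid_coord/= mul1r.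
  rewrite ler_wpM2r ?(ltW t2)//; split => //=.
  by rewrite -[k.+1%:R]natr1; have := sqr_ge0 (w - 1); nra.
exists (false, Ordinal (ltnW kM)); rewrite sqr_grid_coord /grid_coord/= mul1r.
by rewrite ler_wnM2r ?(ltW c0)//; split => //; nra.
Qed.

Lemma grid_round N (w c : 'I_N -> R) : \sum_j w j ^+ 2 <= N%:R ->
  exists2 k, k \in grid N &
    \sum_j w j * c j <= \sum_j grid_coord (k j) * c j.
Proof.
move=> wN.
have /choice[f hf] : forall j, exists s : bool * 'I_N.+2,
    grid_coord s ^+ 2 <= 2 * w j ^+ 2 + 2 /\ w j * c j <= grid_coord s * c j.
  move=> j; apply: grid_round_coord.
  (* Since N >= 1, |w_j| <= N, so rounding up stays within the N + 2 available absolute values. *)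
  have : w j ^+ 2 <= N%:R.
    by apply: le_trans wN; rewrite (bigD1 j)//= lerDl sumr_ge0// => i _; exact: sqr_ge0.
  rewrite -real_normK ?num_real// -natr1 -natr1.
  have : 1 <= N%:R :> R by rewrite ler1n (leq_trans _ (ltn_ord j)).
  by have := normr_ge0 (w j); nra.
exists (finfun f).
  rewrite mem_grid; apply: (@le_trans _ _ (\sum_j (2 * w j ^+ 2 + 2))).
    by apply: ler_sum => j _; rewrite ffunE; exact: (hf j).1.
  by rewrite big_split/= -mulr_sumr sumr_const card_ord -[2 *+ N]mulr_natr; lra.
by apply: ler_sum => j _; rewrite ffunE; exact: (hf j).2.
Qed.

Lemma opnorm_le_grid m n (B : 'I_m -> 'I_n -> R) (t : R) :
  (forall k l, k \in grid m -> l \in grid n ->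
    \sum_i \sum_j grid_coord (k i) * grid_coord (l j) * B i j <= t) ->
  forall h : 'I_n -> R,
    m%:R * n%:R * \sum_i (\sum_j B i j * h j) ^+ 2 <= t ^+ 2 * \sum_j h j ^+ 2.
Proof.
move=> Bt h; set y := fun i => \sum_j B i j * h j.
set Y := \sum_i _; set H := \sum_j _.
have H0 : 0 <= H by apply: sumr_ge0 => j _; exact: sqr_ge0.
have : 0 <= Y by apply: sumr_ge0 => i _; exact: sqr_ge0.
rewrite le_eqVlt => /predU1P[<-|Y0]; first by rewrite mulr0 mulr_ge0// sqr_ge0.
have Hpos : 0 < H.
  rewrite lt_neqAle H0 andbT eq_sym; apply/eqP => H00.
  have h0 j : h j = 0.
    apply/eqP; rewrite -sqrf_eq0; move/eqP: H00.
    by rewrite psumr_eq0 => [/allP/(_ j)|i _]; rewrite ?mem_index_enum ?sqr_ge0//; exact.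
  move: Y0; rewrite /Y big1 ?ltxx// => i _.
  by rewrite big1 ?expr0n// => j _; rewrite h0 mulr0.
(* With y = B h, the vectors [al] y and [be] h have squared norms m and n, and their bilinear value
   is [al] [be] Y. *)
set al := Num.sqrt (m%:R / Y); set be := Num.sqrt (n%:R / H).
have al2 : al ^+ 2 = m%:R / Y by rewrite sqr_sqrtr// divr_ge0// ltW.
have be2 : be ^+ 2 = n%:R / H by rewrite sqr_sqrtr// divr_ge0// ltW.
(* The left vector is rounded first, against B ([be] h); the right one is then rounded against the
   transpose of B applied to the chosen k. *)
have [|k km hk] := @grid_round m (fun i => al * y i)
    (fun i => \sum_j B i j * (be * h j)).
  under eq_bigr do rewrite exprMn.
  by rewrite -mulr_sumr al2 divfK// gt_eqF.
have [|l ln hl] := @grid_round n (fun j => be * h j)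
    (fun j => \sum_i grid_coord (k i) * B i j).
  under eq_bigr do rewrite exprMn.
  by rewrite -mulr_sumr be2 divfK// gt_eqF.
have abY : al * be * Y <= t.
  apply: le_trans (Bt k l km ln).
  have -> : al * be * Y = \sum_i al * y i * \sum_j B i j * (be * h j).
    rewrite mulr_sumr; apply: eq_bigr => i _.
    have -> : \sum_j B i j * (be * h j) = be * y i.
      by rewrite mulr_sumr; apply: eq_bigr => j _; ring.
    by rewrite -/(y i); ring.
  apply: (le_trans hk).
  have -> : \sum_i grid_coord (k i) * (\sum_j B i j * (be * h j)) =
      \sum_j be * h j * \sum_i grid_coord (k i) * B i j.
    under eq_bigr do rewrite mulr_sumr.
    rewrite exchange_big/=; apply: eq_bigr => j _; rewrite mulr_sumr.
    by apply: eq_bigr => i _; ring.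
  apply: (le_trans hl); rewrite [leRHS]exchange_big/=.
  apply: ler_sum => j _; rewrite mulr_sumr.
  by apply: ler_sum => i _; rewrite mulrA (mulrC (grid_coord (l j))).
have ab0 : 0 <= al * be * Y by rewrite !mulr_ge0 ?sqrtr_ge0// ltW.
have : (al * be * Y) ^+ 2 <= t ^+ 2.
  by apply: lerXn2r; rewrite ?nnegrE// (le_trans ab0).
rewrite !exprMn al2 be2.
have -> : m%:R / Y * (n%:R / H) * Y ^+ 2 = m%:R * n%:R * Y / H.
  by field; rewrite !gt_eqF.
by rewrite ler_pdivrMr.
Qed.

End IntegerGrid.

(** * Upper tail for the operator norm of a Gaussian matrix *)

Section GaussianMatrix.
Context {d : measure_display} {T : measurableType d} {R : realType}.
Variable P : probability T R.
Context {m n : nat}.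
Variable a : 'I_m -> {RV P >-> n.-tuple R}.
Hypothesis gauss : forall i, std_gaussian_vector (a i).
Hypothesis indep : independent_RVs a.

Let entry (p : 'I_m * 'I_n) (w : T) : R := tnth (a p.1 w) p.2.

Lemma measurable_entry p : measurable_fun setT (entry p).
Proof.
by apply: (measurableT_comp (measurable_tnth p.2)); exact: measurable_funP.
Qed.

Lemma entry_iid (B : 'I_m * 'I_n -> set R) : (forall p, measurable (B p)) ->
  P (\bigcap_p (entry p @^-1` B p)) = (\prod_p normal_prob 0 1 (B p))%E.
Proof.
move=> mB.
pose box i : set (n.-tuple R) := [set t | forall j, B (i, j) (tnth t j)].
have mbox i : measurable (box i).
  have -> : box i = \bigcap_(j in setT) ((fun t : n.-tuple R => tnth t j) @^-1` B (i, j)).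
    by apply/seteqP; split=> t /= ht j; have := ht j; exact.
  apply: fin_bigcap_measurable => // j _.
  by rewrite -[X in measurable X]setTI; exact: measurable_tnth.
have -> : \bigcap_p (entry p @^-1` B p) =
    \bigcap_(i in [set` [set: 'I_m]%SET]) (a i @^-1` box i).
  apply/seteqP; split=> w /= hw.
    by move=> i _ j; exact: (hw (i, j)).
  by move=> [i j] _; apply: (hw i); rewrite /= inE.
rewrite indep//.
have -> : (\prod_p normal_prob 0 1 (B p) =
    \prod_i \prod_j normal_prob 0 1 (B (i, j)))%E.
  by rewrite pair_bigA; apply: eq_bigr => -[].
under eq_bigl do rewrite inE.
by apply: eq_bigr => i _; rewrite -(gauss i).
Qed.

Lemma expectation_expR_linear (b : 'I_m * 'I_n -> R) :
  (\int[P]_w (expR (\sum_p b p * entry p w))%:E =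
    (expR (\sum_p b p ^+ 2 / 2))%:E)%E.
Proof.
under eq_integral do rewrite expR_sum.
rewrite expR_sum.
apply: (expectation_prod_iid P (normal_prob 0 1) _ _ measurable_entry entry_iid
  (fun p x => expR (b p * x))) => [p|p y|p].
- by apply: measurableT_comp => //; exact: measurable_funM.
- exact: expR_ge0.
- exact: normal_prob_mgf.
Qed.

Lemma gaussian_opnorm_tail (s : R) : (0 < m)%N -> (0 < n)%N -> 0 <= s ->
  exists E : set T,
    [/\ measurable E, ((1 - expR (- s))%:E <= P E)%E &
        forall w, E w -> forall h : 'cV[R]_n,
          \sum_i dot (vec_of_tuple (a i w)) h ^+ 2 <=
          32 * (6 * (m%:R + n%:R) + s) * dot h h].
Proof.
move=> m0 n0 s0.
have mR : 0 < m%:R :> R by rewrite ltr0n.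
have nR : 0 < n%:R :> R by rewrite ltr0n.
set La : R := 32 * (6 * (m%:R + n%:R) + s).
have La0 : 0 < La by rewrite /La; lra.
have mn0 : 0 < m%:R * n%:R :> R by rewrite mulr_gt0.
(* This [lam] minimizes 8 lam^2 m n - lam t at the target t = sqrt ([La] m n), where 8 lam^2 m n
   bounds the logarithm of each exponential moment. At this choice the moment is at most e^([La]/32)
   and lam t = [La]/16. *)
pose lam := Num.sqrt (La / (m%:R * n%:R)) / 16.
have lam0 : 0 < lam by rewrite divr_gt0// sqrtr_gt0 divr_gt0.
have lam2 : 256 * lam ^+ 2 * (m%:R * n%:R) = La.
  rewrite /lam exprMn sqr_sqrtr ?divr_ge0 ?ltW//; field.
  by rewrite !gt_eqF.
pose coef (k : {ffun 'I_m -> bool * 'I_m.+2}) (l : {ffun 'I_n -> bool * 'I_n.+2})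
  (p : 'I_m * 'I_n) : R := lam * (grid_coord (k p.1) * grid_coord (l p.2)).
pose F w := \sum_(k in grid m) \sum_(l in grid n)
  expR (\sum_p coef k l p * entry p w).
have mexp k l : measurable_fun setT (fun w => expR (\sum_p coef k l p * entry p w)).
  apply: measurableT_comp => //; apply: measurable_sum => p.
  by apply: measurable_funM => //; exact: measurable_entry.
have mF : measurable_fun setT F.
  rewrite /F; under eq_fun do rewrite -big_filter.
  apply: measurable_sum => k; under eq_fun do rewrite -big_filter.
  exact: measurable_sum.
have F0 w : 0 <= F w.
  by do 2!(apply: sumr_ge0 => ? _); exact: expR_ge0.
have intF : (\int[P]_w (F w)%:E <= (expR (6 * (m%:R + n%:R) + La / 32))%:E)%E.
  rewrite /F; under eq_integral do rewrite -sumEFin -big_filter.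
  rewrite ge0_integral_sum//; last 2 first.
  - move=> k; apply/measurable_EFinP; under eq_fun do rewrite -big_filter.
    exact: measurable_sum.
  - by move=> k w _; rewrite lee_fin; apply: sumr_ge0 => ? _; exact: expR_ge0.
  rewrite big_filter.
  apply: (@le_trans _ _ (\sum_(k in grid m) \sum_(l in grid n)
      (expR (La / 32))%:E)%E); last first.
    under eq_bigr do rewrite sumEFin.
    rewrite sumEFin lee_fin expRD mulrDr expRD !sumr_const.
    rewrite -mulrnA -[leLHS]mulr_natl mulnC natrM.
    rewrite ler_wpM2r ?expR_ge0// ler_pM//; exact: card_grid_le.
  apply: lee_sum => k kg.
  under eq_integral do rewrite -sumEFin -big_filter.
  rewrite ge0_integral_sum//; last by move=> l; exact/measurable_EFinP.
  rewrite big_filter; apply: lee_sum => l lg.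
  rewrite expectation_expR_linear lee_fin ler_expR.
  have -> : \sum_p coef k l p ^+ 2 / 2 = lam ^+ 2 / 2 *
     ((\sum_i grid_coord (k i) ^+ 2) * (\sum_j grid_coord (l j) ^+ 2)).
    rewrite mulr_suml mulr_sumr.
    under [RHS]eq_bigr do rewrite !mulr_sumr.
    rewrite pair_bigA; apply: eq_bigr => -[i j] _; rewrite /coef/=.
    by field.
  have kl : (\sum_i grid_coord (k i) ^+ 2) * (\sum_j grid_coord (l j) ^+ 2) <=
      (4 * m%:R) * (4 * n%:R) :> R.
    by rewrite ler_pM ?sumr_ge0// -?mem_grid// => i _; exact: sqr_ge0.
  rewrite -lam2.
  have := ler_wpM2l (sqr_ge0 lam) kl; lra.
pose E := [set w | F w < expR (La / 16)].
have EC : ~` E = [set w | expR (La / 16) <= F w].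
  by apply/seteqP; split=> w /=; rewrite leNgt => /negP.
have mEC : measurable [set w | expR (La / 16) <= F w].
  rewrite -[X in measurable X]setTI.
  exact: measurable_fun_le.
have mE : measurable E by rewrite -(setCK E) EC; exact: measurableC.
exists E; split => //.
  have PEC : (P (~` E) <= (expR (- s))%:E)%E.
    (* Markov's inequality at level e^([La]/16). The resulting exponent is 6(m + n) + [La]/32 -
       [La]/16 = - s, which is what fixes [La]. *)
    have := @le_integral_abse _ _ _ P setT measurableT (EFin \o F)
      (expR (La / 16)) ((measurable_EFinP _ _).2 mF) (expR_gt0 _).
    rewrite setTI.
    have -> : [set x | ((expR (La / 16))%:E <= `|(EFin \o F) x|)%E] = ~` E.
      rewrite EC; apply/seteqP; split=> w /=; rewrite ger0_norm ?lee_fin//.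
    under eq_integral do rewrite gee0_abs ?lee_fin//.
    move=> /le_trans/(_ intF).
    have -> : expR (6 * (m%:R + n%:R) + La / 32) = expR (La / 16) * expR (- s).
      by rewrite -expRD; congr expR; rewrite /La; field.
    by rewrite EFinM lee_pmul2l// lte_fin expR_gt0.
  rewrite -(setCK E) probability_setC; last exact: measurableC.
  by rewrite EFinB leeB.
move=> w Ew h.
have step k l : k \in grid m -> l \in grid n ->
    \sum_i \sum_j grid_coord (k i) * grid_coord (l j) * tnth (a i w) j <=
    La / 16 / lam.
  move=> km ln.
  (* All terms of [F] are nonnegative, so each one alone is below the threshold. *)
  have : expR (\sum_p coef k l p * entry p w) < expR (La / 16).
    apply: le_lt_trans Ew; rewrite /F (bigD1 k)//= (bigD1 l)//=.
    rewrite -addrA lerDl addr_ge0 ?sumr_ge0// => *.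
    by rewrite sumr_ge0// => *; exact: expR_ge0.
  rewrite ltr_expR => /ltW h1; rewrite ler_pdivlMr//; apply: le_trans h1.
  rewrite mulr_suml; under eq_bigr do rewrite mulr_suml.
  rewrite pair_bigA; apply: ler_sum => -[i j] _.
  by rewrite /coef /entry/= mulrC !mulrA.
have /= := opnorm_le_grid _ _ _ _ step (fun j => h j 0).
have -> : (La / 16 / lam) ^+ 2 = La * (m%:R * n%:R).
  by rewrite -[in RHS]lam2 -lam2; field; rewrite gt_eqF.
have -> : \sum_j h j 0 ^+ 2 = dot h h.
  by rewrite /dot mxE; apply: eq_bigr => j _; rewrite mxE expr2.
have -> : \sum_i (\sum_j tnth (a i w) j * h j 0) ^+ 2 =
    \sum_i dot (vec_of_tuple (a i w)) h ^+ 2.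
  apply: eq_bigr => i _; congr (_ ^+ 2); rewrite /dot mxE.
  by apply: eq_bigr => j _; rewrite !mxE.
by move=> hS; rewrite -(ler_pM2l mn0) (le_trans hS)// [leLHS]mulrAC [leLHS]mulrC.
Qed.

End GaussianMatrix.

(** * From the operator norm to the gradient inequality *)

Lemma dotC (R : realType) (n : nat) (u v : 'cV[R]_n) : dot u v = dot v u.
Proof.
by rewrite /dot !mxE; apply: eq_bigr => j _; rewrite !mxE mulrC.
Qed.

Lemma dotBr (R : realType) (n : nat) (u v w : 'cV[R]_n) :
  dot u (v - w) = dot u v - dot u w.
Proof. by rewrite /dot mulmxBr !mxE. Qed.

Lemma dot_tanhwfq_grad_ge (R : realType) (m n : nat) (b : 'I_m -> 'cV[R]_n)
    (x h : 'cV[R]_n) :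
  - 3 * (m%:R^-1 * \sum_i dot (b i) h ^+ 2) <=
  - dot h (tanhwfq_grad b x (x - h)).
Proof.
have -> : dot h (tanhwfq_grad b x (x - h)) = m%:R^-1 * \sum_i
    (dot (b i) (x - h) - dot (b i) x *
      tanh_factor (dot (b i) x) (dot (b i) (x - h))) *
    (dot (b i) x - dot (b i) (x - h)).
  rewrite /tanhwfq_grad {1}/dot -scalemxAr mxE mulmx_sumr summxE; congr (_ * _).
  apply: eq_bigr => i _; rewrite -scalemxAr mxE -/(dot h (b i)) (dotC _ _ h).
  by congr (_ * _); rewrite dotBr subKr.
rewrite mulrCA -mulrN ler_wpM2l ?invr_ge0// mulr_sumr -sumrN.
apply: ler_sum => i _.
have -> : dot (b i) h = dot (b i) x - dot (b i) (x - h) by rewrite dotBr subKr.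
exact: tanhwfq_term_ge.
Qed.

Theorem proposition1 (R : realType) :
  exists C1 C2 C3 c : R,
    [/\ 0 < C1, 0 < C2, 0 < C3 & 0 < c] /\
    forall (m n : nat) (x : 'cV[R]_n) (u : R),
      (0 < m)%N -> (0 < n)%N -> 0 < u ->
    forall (d : measure_display) (T : measurableType d) (P : probability T R)
      (a : 'I_m -> {RV P >-> n.-tuple R}),
      (forall i, std_gaussian_vector (a i)) ->
      independent_RVs a ->
    exists E : set T,
      [/\ measurable E,
          ((1 - expR (- (c * m%:R * Num.min u (u ^+ 2))))%:E <= P E)%E &
          forall w, E w -> forall h : 'cV[R]_n,
            - dot h (tanhwfq_grad (fun i => vec_of_tuple (a i w)) x (x - h)) >=
            (1 - C3 - (C1 * (n%:R / m%:R) + C2 * Num.sqrt (n%:R / m%:R)) - u)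
              * enorm h ^+ 2].
Proof.
(* The tail bound with s = m u / 96 gives (1/m) sum_i (a_i^T h)^2 <= (192 (1 + n/m) + u/3) |h|^2.
   Multiplying by 3 yields [C1] = 576, the coefficient 1 of u, and 1 - [C3] = - 576. The square-root
   term is nonnegative and is subtracted, so [C2] = 1 is enough. *)
exists 576, 1, 577, 96^-1; split; first by split; rewrite ?invr_gt0 ?ltr01 ?ltr0n.
move=> m n x u m0 n0 u0 d T P a gauss indep.
have mR : 0 < m%:R :> R by rewrite ltr0n.
have [|E [mE PE hE]] := @gaussian_opnorm_tail _ _ _ P m n a gauss indep
  (96^-1 * m%:R * u) m0 n0; first by rewrite !mulr_ge0// ?invr_ge0 ltW.
exists E; split => //.
  (* The event fails with probability at most e^(- m u / 96), and min (u, u^2) <= u. *)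
  apply: le_trans PE; rewrite lee_fin lerD2l lerN2 ler_expR lerN2.
  by rewrite ler_wpM2l ?mulr_ge0 ?invr_ge0// ge_min lexx.
move=> w Ew h; apply: le_trans (dot_tanhwfq_grad_ge _ _ _ _ _ _).
have hh : 0 <= dot h h.
  by rewrite /dot mxE sumr_ge0// => j _; rewrite mxE -expr2 sqr_ge0.
rewrite sqr_sqrtr//.
have := hE w Ew h; set S := \sum_i _ => hS.
have : m%:R^-1 * S <= (192 * (1 + n%:R / m%:R) + u / 3) * dot h h.
  rewrite mulrC ler_pdivrMr// (le_trans hS)//.
  by rewrite le_eqVlt; apply/orP; left; apply/eqP; field; rewrite gt_eqF.
have : 0 <= Num.sqrt (n%:R / m%:R) * dot h h by rewrite mulr_ge0.
set q := n%:R / m%:R; set r := Num.sqrt q; set D := dot h h in hh *.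
set V := _^-1 * S; lra.
Qed.
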